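(* Let $n\ge 1$ and let $\psi\in\mathcal{R}^-_n$. Let $A=(A_1,\dots,A_n)$ and $A'=(A'_1,\dots,A'_n)$ be $n$-tuples of bounded nonpositive self-adjoint operators on a complex Hilbert space $H$ such that all the operators $A_1,\dots,A_n,A'_1,\dots,A'_n$ commute pairwise. If $A_j\le A'_j$ for all $j=1,\dots,n$, then $\psi(A)\le\psi(A')$.
   Context: Write $\mathbb{R}_+^n=[0,\infty)^n$. Class $\mathcal{R}^-_n$: a nonpositive continuous function $\psi$ on $(-\infty,0]^n$ belongs to $\mathcal{R}^-_n$ if there exist numbers $\lambda>0$, $\gamma\ge 0$ and a positive (Borel) measure $\tau$ on $\mathbb{R}_+^n$ such that for all $z\in\mathbb{C}^n$ with $\operatorname{Re} z_j>0$ $(j=1,\dots,n)$ $$\frac{1}{\lambda-\psi(-z)}=\gamma+\int_{\mathbb{R}_+^n}\frac{d\tau(\xi)}{(\xi_1+z_1)\cdots(\xi_n+z_n)}.$$ For non-real arguments, $\psi(-z)$ denotes the value of the holomorphic extension of $\psi$ to $\{w\in\mathbb{C}^n:\operatorname{Re} w_j<0,\ j=1,\dots,n\}$, which is assumed to exist. Functional calculus: for an $n$-tuple $A=(A_1,\dots,A_n)$ of pairwise commuting bounded self-adjoint operators, $E$ denotes the product of the spectral measures of $A_1,\dots,A_n$ (the joint spectral measure on $\mathbb{R}^n$), and $\sigma(A)$ denotes the joint spectrum of $A$ (equivalently, the support of $E$). For a real function $f$ continuous on $\sigma(A)$, one sets $f(A)=\int_{\sigma(A)}f(s)\,dE(s)$.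 The order $S\le T$ between bounded self-adjoint operators means that $T-S$ is positive semidefinite. *)

(* Defs.v *)
From HB Require Import structures.
From mathcomp Require Import all_boot all_order all_algebra.
From mathcomp Require Import sesquilinear complex.
From mathcomp Require Import all_classical all_reals all_analysis.

Set Implicit Arguments.
Unset Strict Implicit.
Unset Printing Implicit Defensive.

Import Order.TTheory GRing.Theory Num.Theory.
Import numFieldNormedType.Exports.

Local Open Scope classical_set_scope.
Local Open Scope ring_scope.
Local Open Scope complex_scope.

(* R^n with its Borel sigma-algebra. *)
Definition borelRn (R : realType) (n : nat) :=
  g_sigma_algebraType (@open 'rV[R]_n).

Definition complex_integrable (R : realType) d (T : measurableType d)
    (mu : {measure set T -> \bar R}) (D : set T) (f : T -> R[i]) : Prop :=
  mu.-integrable D (EFin \o (fun t => complex.Re (f t))) /\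
  mu.-integrable D (EFin \o (fun t => complex.Im (f t))).

Definition complex_integral (R : realType) d (T : measurableType d)
    (mu : {measure set T -> \bar R}) (D : set T) (f : T -> R[i]) : R[i] :=
  (\int[mu]_(t in D) complex.Re (f t)) +i* (\int[mu]_(t in D) complex.Im (f t)).

(* Psi is defined on all of C^n, but only its values on {Re w_j < 0} matter;
   likewise psi is only constrained on (-oo, 0]^n. *)
Definition holomorphic_extension (R : realType) (n : nat)
    (psi : 'rV[R]_n -> R) (Psi : 'rV[R[i]]_n -> R[i]) : Prop :=
  (forall w : 'rV[R[i]]_n, (forall j, complex.Re (w 0 j) < 0) ->
     differentiable (Psi : 'rV[R[i]^o]_n -> R[i]^o) (w : 'rV[R[i]^o]_n)) /\
  (forall s : 'rV[R]_n, (forall j, s 0 j < 0) ->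
     Psi (map_mx (fun r : R => r%:C) s) = (psi s)%:C).

(* The condition lambda%:C - Psi (- z) != 0 is implicit in writing
   1 / (lambda - psi(-z)); it is stated because 0^-1 = 0 here. *)
Definition class_Rminus (R : realType) (n : nat) (psi : 'rV[R]_n -> R) : Prop :=
  [/\ {within [set s : 'rV[R]_n | forall j, s 0 j <= 0], continuous psi},
      (forall s : 'rV[R]_n, (forall j, s 0 j <= 0) -> psi s <= 0) &
      exists Psi : 'rV[R[i]]_n -> R[i],
        holomorphic_extension psi Psi /\
        exists (lambda gamma : R) (tau : {measure set (borelRn R n) -> \bar R}),
          [/\ 0 < lambda, 0 <= gamma &
          forall z : 'rV[R[i]]_n, (forall j, 0 < complex.Re (z 0 j)) ->
            let orthant := [set xi : borelRn R n |
                              forall j, 0 <= (xi : 'rV[R]_n) 0 j] in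
            let kernel (xi : borelRn R n) :=
              (\prod_(j < n) (((xi : 'rV[R]_n) 0 j)%:C + z 0 j))^-1 in
            [/\ lambda%:C - Psi (- z) != 0,
                complex_integrable tau orthant kernel &
                (lambda%:C - Psi (- z))^-1 =
                  gamma%:C + complex_integral tau orthant kernel]]].

(* A complex Hilbert space is a complete normed module over R[i] whose norm is
   induced by an inner product (linear in its first argument). *)
Definition induces_norm (R : realType) (H : completeNormedModType R[i])
    (ip : {dot H for Num.conj}) : Prop :=
  forall x : H, ip x x = `|x| ^+ 2.

Definition bounded_op (R : realType) (H : completeNormedModType R[i])
    (S : H -> H) : Prop :=
  exists M : R, forall x : H, `|S x| <= M%:C * `|x|.

Definition self_adjoint (R : realType) (H : completeNormedModType R[i])
    (ip : {dot H for Num.conj}) (S : H -> H) : Prop :=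
  forall x y : H, ip (S x) y = ip x (S y).

(* In the order of R[i], 0 <= w says that w is real and nonnegative. *)
Definition op_le (R : realType) (H : completeNormedModType R[i])
    (ip : {dot H for Num.conj}) (S T : H -> H) : Prop :=
  forall x : H, 0 <= ip (T x - S x) x.

Definition commuting (R : realType) (H : completeNormedModType R[i])
    (S T : H -> H) : Prop :=
  forall x : H, S (T x) = T (S x).

(* Values of E on nonmeasurable sets are irrelevant. *)
Definition projection_valued_measure (R : realType)
    (H : completeNormedModType R[i]) (ip : {dot H for Num.conj})
    d (T : measurableType d) (E : set T -> {linear H -> H}) : Prop :=
  [/\ forall B, measurable B ->
        [/\ bounded_op (E B), self_adjoint ip (E B) &
            forall x, E B (E B x) = E B x],
      forall x, E set0 x = 0,
      forall x, E setT x = x,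
      forall B C, measurable B -> measurable C ->
        forall x, E (B `&` C) x = E B (E C x) &
      forall F : (set T)^nat, (forall k, measurable (F k)) ->
        trivIset setT F -> forall x,
        (fun m => \sum_(k < m) E (F k) x) @ \oo --> E (\bigcup_k F k) x].

(* The scalar measure B |-> (E(B) x, x). *)
Definition scalar_measure (R : realType) (H : completeNormedModType R[i])
    (ip : {dot H for Num.conj}) d (T : measurableType d)
    (E : set T -> {linear H -> H}) (x : H) : set T -> \bar R :=
  fun B => (complex.Re (ip (E B x) x))%:E.

(* S is the (weakly defined) integral of the real function f against E over D:
   (S x, x) is the integral of f against (E(.) x, x), for every x; by
   polarization this determines S. *)
Definition is_spectral_integral (R : realType) (H : completeNormedModType R[i])
    (ip : {dot H for Num.conj}) d (T : measurableType d)
    (E : set T -> {linear H -> H}) (D : set T) (f : T -> R)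
    (S : H -> H) : Prop :=
  bounded_op S /\
  forall x : H, complex.Im (ip (S x) x) = 0 /\
    (complex.Re (ip (S x) x))%:E =
      (\int[scalar_measure ip E x]_(t in D) (f t)%:E)%E.

(* The boundedly supported projection-valued measure with S = \int t dE(t). *)
Definition spectral_measure_of (R : realType) (H : completeNormedModType R[i])
    (ip : {dot H for Num.conj}) (S : H -> H)
    (E : set R -> {linear H -> H}) : Prop :=
  [/\ projection_valued_measure ip E,
      exists M : R, forall x, E [set t | M < `|t|] x = 0 &
      is_spectral_integral ip E setT id S].

(* E(B_1 x ... x B_n) = E_1(B_1) ... E_n(B_n) for the spectral measures E_j
   of the A_j. *)
Definition joint_spectral_measure (R : realType) (n : nat)
    (H : completeNormedModType R[i]) (ip : {dot H for Num.conj})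
    (A : 'I_n -> {linear H -> H})
    (E : set (borelRn R n) -> {linear H -> H}) : Prop :=
  exists Ej : 'I_n -> set R -> {linear H -> H},
    [/\ forall j, spectral_measure_of ip (A j) (Ej j),
        projection_valued_measure ip E &
        forall B : 'I_n -> set R, (forall j, measurable (B j)) ->
          forall x,
            E [set s | forall j, B j ((s : 'rV[R]_n) 0 j)] x =
            (\big[(fun S T : H -> H => S \o T)/idfun]_(j < n)
               (Ej j (B j) : H -> H)) x].

Definition pvm_support (R : realType) (n : nat)
    (H : completeNormedModType R[i])
    (E : set (borelRn R n) -> {linear H -> H}) : set (borelRn R n) :=
  [set s | forall U : set 'rV[R]_n, open U -> U s -> exists x, E U x != 0].

(* S = f(A), i.e. S is the integral of f over the joint spectrum of A (the
   support of the joint spectral measure) against that measure. *)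
Definition is_functional_calculus (R : realType) (n : nat)
    (H : completeNormedModType R[i]) (ip : {dot H for Num.conj})
    (A : 'I_n -> {linear H -> H}) (f : 'rV[R]_n -> R) (S : H -> H) : Prop :=
  exists E : set (borelRn R n) -> {linear H -> H},
    joint_spectral_measure ip A E /\
    is_spectral_integral ip E (pvm_support E) f S.

(* Main.v *)
Require Import Defs.
From HB Require Import structures.
From mathcomp Require Import all_boot all_order all_algebra.
From mathcomp Require Import sesquilinear complex lra ring.
From mathcomp Require Import all_classical all_reals all_analysis.
From mathcomp Require Import measurable_realfun.

Set Implicit Arguments.
Unset Strict Implicit.
Unset Printing Implicit Defensive.

Import Order.TTheory GRing.Theory Num.Theory.
Import numFieldNormedType.Exports.
Import HBNNSimple.

Local Open Scope classical_set_scope.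
Local Open Scope ring_scope.
Local Open Scope complex_scope.

(** The integral formula makes [psi] nondecreasing in each variable. At a real
    point [s] with negative coordinates the integrand of [1 / (lambda - psi s)]
    is the product of the [(xi_j - s_j)^-1], which grows with every [s_j], and
    [lambda - psi s] is positive; continuity carries the monotonicity to the
    closed orthant ([class_Rminus_le]).

    It remains to see that a continuous nondecreasing function respects the
    order of commuting tuples. For one pair [A_j <= A'_j] the spectral
    projections of rays are ordered, [E_j ]c, oo[ <= E'_j ]c, oo[]
    ([spectral_ray_pvm_le]). Indeed commutation passes from the operators to the
    projections of rays ([commute_spectral_ray]), so it suffices to exclude, for
    [t < s], a nonzero vector lying in the ranges of both [E_j ]s, oo[] and
    [E'_j ]-oo, t]]: on it the form of [A_j] would be at least [s] and the one
    of [A'_j] at most [t].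

    An order between projections [E U] and [E' U] is an inclusion of kernels
    ([pvm_le]); it survives countable unions and, by passing to complements,
    intersections. From rays it therefore passes to the open orthants
    [{s | q < s}], and from those to the superlevel sets of [psi], because inside
    the nonpositive orthant a superlevel set of a continuous nondecreasing
    function is a countable union of orthants with rational corners
    ([superlevelE]). Hence the scalar measure of [x] for [A] gives every
    sublevel set of [psi] at least the mass given by the one for [A'], and the
    layer cake formula turns this into the inequality between the integrals of
    [psi] ([le_integral_of_ccdf]). The integrals run over the supports of the
    joint spectral measures, which have full measure ([pvm_support_full]) and
    lie in the nonpositive orthant. *)

(** * The real inner product of a complex Hilbert space *)

Section real_inner_product.
Variables (R : realType) (H : completeNormedModType R[i]).
Variable ip : {dot H for Num.conj}.
Hypothesis ipN : induces_norm ip.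

(** Forms of self-adjoint operators are real, so that all estimates below take
    place in the underlying real inner product space. *)
Definition rdot (x y : H) : R := complex.Re (ip x y).

Local Notation "<[ x , y ]>" := (rdot x y) (at level 0, format "<[ x ,  y ]>").

Lemma rdotDl x y z : <[x + y, z]> = <[x, z]> + <[y, z]>.
Proof. by rewrite /rdot linearDl raddfD. Qed.

Lemma rdotNl x y : <[- x, y]> = - <[x, y]>.
Proof. by rewrite /rdot linearNl raddfN. Qed.

Lemma rdotBl x y z : <[x - y, z]> = <[x, z]> - <[y, z]>.
Proof. by rewrite rdotDl rdotNl. Qed.

Lemma rdotZl (r : R) x y : <[r%:C *: x, y]> = r * <[x, y]>.
Proof.
have ReZ (z : R[i]) : complex.Re (r%:C * z) = r * complex.Re z.
  by case: z => a b /=; rewrite mul0r subr0.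
by rewrite /rdot linearZl_LR; exact: ReZ.
Qed.

Lemma rdotC x y : <[x, y]> = <[y, x]>.
Proof.
have ReJ (z : R[i]) : complex.Re (Num.conj z) = complex.Re z by case: z.
by rewrite /rdot hermC expr0 mul1r; exact: ReJ.
Qed.

Lemma rdotDr x y z : <[z, x + y]> = <[z, x]> + <[z, y]>.
Proof. by rewrite rdotC rdotDl !(rdotC z). Qed.

Lemma rdotBr x y z : <[z, x - y]> = <[z, x]> - <[z, y]>.
Proof. by rewrite rdotC rdotBl !(rdotC z). Qed.

Lemma rdotZr (r : R) x y : <[x, r%:C *: y]> = r * <[x, y]>.
Proof. by rewrite rdotC rdotZl rdotC. Qed.

Lemma ip_self x : ip x x = <[x, x]>%:C.
Proof.
have : 0 <= ip x x by rewrite ipN exprn_ge0.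
have ge0E (z : R[i]) : 0 <= z -> z = (complex.Re z)%:C.
  by case: z => a b; rewrite lecE /= => /andP[/eqP -> _].
exact: ge0E.
Qed.

Lemma rdot_ge0 x : 0 <= <[x, x]>.
Proof. by rewrite -lecR -ip_self ipN exprn_ge0. Qed.

Lemma rdot_eq0 x : <[x, x]> = 0 -> x = 0.
Proof.
move=> x0; apply/eqP; rewrite -normr_eq0 -sqrf_eq0 -ipN ip_self x0.
by rewrite eqxx.
Qed.

Lemma rdot_le0 x : <[x, x]> <= 0 -> x = 0.
Proof. by move=> x0; apply: rdot_eq0; apply/eqP; rewrite eq_le x0 rdot_ge0. Qed.

Lemma rdot0l x : <[0, x]> = 0.
Proof. by rewrite -(subrr (0 : H)) rdotBl subrr. Qed.

Lemma rdot0r x : <[x, 0]> = 0.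
Proof. by rewrite rdotC rdot0l. Qed.

Lemma rdot_eq0r x : (forall y, <[x, y]> = 0) -> x = 0.
Proof. by move=> /(_ x); exact: rdot_eq0. Qed.

(** The discriminant argument is run for an arbitrary positive symmetric
    operator [S]: the identity gives the usual Cauchy-Schwarz inequality, and the
    shifted operators below turn bounds of forms into bounds of norms. *)
Lemma form_cauchy_schwarz (S : {linear H -> H}) x y :
  (forall u v, <[S u, v]> = <[u, S v]>) -> (forall u, 0 <= <[S u, u]>) ->
  <[S x, y]> ^+ 2 <= <[S x, x]> * <[S y, y]>.
Proof.
move=> Ssym Spos.
have q t : 0 <= <[S x, x]> + t * <[S x, y]> *+ 2 + t ^+ 2 * <[S y, y]>.
  have := Spos (x + t%:C *: y); rewrite linearD linearZ_LR.
  rewrite rdotDl !rdotDr !rdotZl !rdotZr (Ssym y x) (rdotC y).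
  set a := <[_, _]>; set b := <[_, _]>; set c := <[_, _]>; nra.
have := Spos x; have := Spos y; move: q.
move: <[S x, x]> <[S x, y]> <[S y, y]> => a b c q c0 a0.
have [c00|cn0] := eqVneq c 0.
  have [->|bn0] := eqVneq b 0; first by rewrite expr0n mulr_ge0.
  (* The form is affine in [t]; this [t] gives it the value [-1]. *)
  have := q (- (a + 1) / (b *+ 2)).
  rewrite c00 mulr0 addr0.
  have -> : - (a + 1) / (b *+ 2) * b *+ 2 = - (a + 1) by field.
  lra.
have cgt0 : 0 < c by rewrite lt_def cn0.
(* The minimizer of the quadratic polynomial. *)
have := q (- b / c).
have -> : a + - b / c * b *+ 2 + (- b / c) ^+ 2 * c = (a * c - b ^+ 2) / c.
  by field.
by rewrite pmulr_lge0 ?invr_gt0// subr_ge0.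
Qed.

Lemma cauchy_schwarz x y : <[x, y]> ^+ 2 <= <[x, x]> * <[y, y]>.
Proof. by apply: (@form_cauchy_schwarz idfun) => // u; exact: rdot_ge0. Qed.

Lemma op_le_rdot (S T : H -> H) : op_le ip S T ->
  forall x, <[S x, x]> <= <[T x, x]>.
Proof.
move=> ST x; have := ST x; rewrite lecE => /andP[_].
by rewrite -/(rdot _ _) rdotBl subr_ge0.
Qed.

Lemma self_adjoint_rdot (S : H -> H) : self_adjoint ip S ->
  forall x y, <[S x, y]> = <[x, S y]>.
Proof. by move=> Ssa x y; rewrite /rdot Ssa. Qed.

Lemma bounded_op_rdot (S : H -> H) : bounded_op S ->
  exists2 M : R, 0 <= M & forall x, <[S x, S x]> <= M * <[x, x]>.
Proof.
move=> [M SM]; exists (M ^+ 2); first exact: sqr_ge0.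
move=> x; rewrite -lecR rmorphM rmorphXn /= -!ip_self !ipN -exprMn.
by rewrite lerXn2r// nnegrE ?(le_trans _ (SM x)).
Qed.

Lemma cvg_rdot (u : nat -> H) (l x : H) : u @ \oo --> l ->
  (fun k => <[u k, x]>) @ \oo --> <[l, x]>.
Proof.
move=> ul; apply/cvgrPdist_lt => e e0.
have d0 : 0 < e ^+ 2 / (<[x, x]> + 1).
  by rewrite divr_gt0 ?exprn_gt0 ?ltr_wpDl// rdot_ge0.
set d := _ / _ in d0.
have sd0 : (0 : R[i]) < (Num.sqrt d)%:C by rewrite ltcR sqrtr_gt0.
have /cvgrPdist_lt/(_ _ sd0) := ul.
apply: filterS => k uk.
rewrite -rdotBl -ltr_sqr ?nnegrE ?(ltW e0)// real_normK ?num_real//.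
have ulk : <[l - u k, l - u k]> < d.
  rewrite -ltcR -ip_self ipN -(sqr_sqrtr (ltW d0)) rmorphXn /=.
  by rewrite ltrXn2r// ?nnegrE// ltW.
apply: le_lt_trans (cauchy_schwarz _ _) _.
have x0 := rdot_ge0 x; have l0 := rdot_ge0 (l - u k).
have : d * (<[x, x]> + 1) = e ^+ 2 by rewrite /d mulfVK// gt_eqF ?ltr_wpDl.
nra.
Qed.

End real_inner_product.

(** * Scalar measures and null vectors of a projection-valued measure *)

Section pvm_mass.
Variables (R : realType) (H : completeNormedModType R[i]).
Variable ip : {dot H for Num.conj}.
Variables (d : measure_display) (T : measurableType d).
Variable E : set T -> {linear H -> H}.

(** [scalar_measure] cut off outside the measurable sets, where it might be
    negative. The two proofs are arguments so that its measure structure can be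
    inferred from the term. *)
Definition pvm_mass (ipN : induces_norm ip)
    (Epvm : projection_valued_measure ip E) (x : H) : set T -> \bar R :=
  fun B => if `[< measurable B >] then scalar_measure ip E x B else 0%E.

Hypotheses (ipN : induces_norm ip) (Epvm : projection_valued_measure ip E).

Local Notation "<[ x , y ]>" := (rdot ip x y)
  (at level 0, format "<[ x ,  y ]>").

Lemma pvm_sa B : measurable B -> self_adjoint ip (E B).
Proof. by case: Epvm => + _ _ _ _ mB => /(_ _ mB)[]. Qed.

Lemma pvm_bounded B : measurable B -> bounded_op (E B).
Proof. by case: Epvm => + _ _ _ _ mB => /(_ _ mB)[]. Qed.

Lemma pvm_idem B x : measurable B -> E B (E B x) = E B x.
Proof. by case: Epvm => + _ _ _ _ mB => /(_ _ mB)[]. Qed.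

Lemma pvm_set0 x : E set0 x = 0.
Proof. by case: Epvm. Qed.

Lemma pvm_setT x : E setT x = x.
Proof. by case: Epvm. Qed.

Lemma pvmI B C x : measurable B -> measurable C ->
  E (B `&` C) x = E B (E C x).
Proof. by case: Epvm => _ _ _ + _ mB mC => /(_ _ _ mB mC). Qed.

Lemma pvm_sym B x y : measurable B -> <[E B x, y]> = <[x, E B y]>.
Proof. by move=> mB; apply: self_adjoint_rdot (pvm_sa mB) _ _. Qed.

Lemma pvm_rdot B x : measurable B -> <[E B x, x]> = <[E B x, E B x]>.
Proof. by move=> mB; rewrite (pvm_sym _ (E B x))// pvm_idem// pvm_sym. Qed.

Lemma pvm_massE x B : measurable B ->
  pvm_mass ipN Epvm x B = (<[E B x, x]>)%:E.
Proof. by move=> mB; rewrite /pvm_mass asboolT. Qed.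

Let mass0 x : pvm_mass ipN Epvm x set0 = 0%E.
Proof. by rewrite pvm_massE// pvm_set0 rdot0l. Qed.

Let mass_ge0 x B : (0 <= pvm_mass ipN Epvm x B)%E.
Proof.
rewrite /pvm_mass; case: asboolP => // mB.
by rewrite lee_fin -/(rdot _ _ _) pvm_rdot// rdot_ge0.
Qed.

Let mass_sigma_additive x : semi_sigma_additive (pvm_mass ipN Epvm x).
Proof.
move=> F mF tF mUF; rewrite pvm_massE//.
have -> : (fun m => \sum_(0 <= k < m) pvm_mass ipN Epvm x (F k)) =
    EFin \o (fun m => <[\sum_(k < m) E (F k) x, x]>).
  apply/funext => m /=; rewrite big_mkord.
  elim: m => [|m IHm]; first by rewrite !big_ord0 rdot0l.
  by rewrite !big_ord_recr /= IHm pvm_massE// rdotDl EFinD.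
apply: cvg_EFin; first exact: nearW.
apply: cvg_rdot => //.
by case: Epvm => _ _ _ _; exact.
Qed.

HB.instance Definition _ x := isMeasure.Build _ _ _ (pvm_mass ipN Epvm x)
  (mass0 x) (mass_ge0 x) (@mass_sigma_additive x).

Let mass_fin_num x : fin_num_fun (pvm_mass ipN Epvm x).
Proof. by move=> B mB; rewrite pvm_massE. Qed.

HB.instance Definition _ x := Measure_isFinite.Build _ _ _
  (pvm_mass ipN Epvm x) (mass_fin_num x).

Lemma pvm_mass_setT x : pvm_mass ipN Epvm x setT = (<[x, x]>)%:E.
Proof. by rewrite pvm_massE// pvm_setT. Qed.

Lemma pvm_mass_eq0 x B : measurable B ->
  pvm_mass ipN Epvm x B = 0%E <-> E B x = 0.
Proof.
move=> mB; rewrite pvm_massE//; split => [[]|->]; last by rewrite rdot0l.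
by rewrite pvm_rdot// => /(rdot_eq0 ipN).
Qed.

Lemma pvm_contract B x : measurable B -> <[E B x, E B x]> <= <[x, x]>.
Proof.
move=> mB; rewrite -pvm_rdot// -lee_fin -pvm_massE// -pvm_mass_setT.
by apply: (le_measure (pvm_mass ipN Epvm x)); rewrite ?inE.
Qed.

(** Integrals only see the measurable sets, hence are insensitive to the
    arbitrary values of [E] outside of them. *)
Lemma integral_scalar_measure x D f :
  (\int[scalar_measure ip E x]_(t in D) f t =
   \int[pvm_mass ipN Epvm x]_(t in D) f t)%E.
Proof.
rewrite /integral.
suff sE (h : {nnsfun T >-> R}) :
    sintegral (scalar_measure ip E x) h = sintegral (pvm_mass ipN Epvm x) h.
  by congr (ereal_sup _ - ereal_sup _)%E; apply/seteqP; split=> _ [h hf <-];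
    exists h => //.
rewrite /sintegral; apply: eq_fsbigr => r _.
by rewrite /pvm_mass asboolT.
Qed.

(** Additivity of the scalar measure of [x] gives
    [|x - E B x - E (~` B) x|^2 = 0], the two projections being orthogonal. *)
Lemma pvmC B x : measurable B -> E (~` B) x = x - E B x.
Proof.
move=> mB; have mC := measurableC mB; apply/esym/eqP; rewrite -subr_eq0.
apply/eqP/(rdot_eq0 ipN).
have BC : <[E B x, E (~` B) x]> = 0.
  by rewrite pvm_sym// -pvmI// setICr pvm_set0 rdot0r.
have := pvm_mass_setT x; rewrite -(setUv B) measureU ?setICr//.
rewrite /= !pvm_massE// -EFinD => -[].
rewrite !rdotBl !rdotBr (rdotC ip (E (~` B) x) (E B x)) BC.
rewrite (rdotC ip x (E B x)) (rdotC ip x (E (~` B) x)).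
rewrite -!pvm_rdot//; lra.
Qed.

Lemma pvm_fixP B x : measurable B -> E B x = x <-> E (~` B) x = 0.
Proof.
move=> mB; rewrite pvmC//; split=> [->|/eqP]; first by rewrite subrr.
by rewrite subr_eq0 => /eqP.
Qed.

Lemma pvm_null_subset A B x : measurable A -> measurable B -> A `<=` B ->
  E B x = 0 -> E A x = 0.
Proof.
by move=> mA mB /setIidPl <- B0; rewrite pvmI// B0 linear0.
Qed.

Lemma pvm_null_bigcup (I : countType) (D : set I) (F : I -> set T) x :
  (forall i, D i -> measurable (F i)) -> (forall i, D i -> E (F i) x = 0) ->
  E (\bigcup_(i in D) F i) x = 0.
Proof.
move=> mF F0.
(* The family enumerated by [nat] through the codes of its indices. *)
pose G k := if (unpickle k : option I) is Some i then
  if `[< D i >] then F i else set0 else set0.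
have mG k : measurable (G k).
  rewrite /G; case: unpickle => [i|//].
  by case: asboolP => // /mF.
have G0 k : pvm_mass ipN Epvm x (G k) = 0%E.
  apply/pvm_mass_eq0 => //; rewrite /G.
  case: unpickle => [i|]; last exact: pvm_set0.
  by case: asboolP => [/F0//|_]; exact: pvm_set0.
have -> : \bigcup_(i in D) F i = \bigcup_k G k.
  apply/seteqP; split=> [t [i Di Ft]|t [k _]].
    by exists (pickle i) => //; rewrite /G pickleK asboolT.
  by rewrite /G; case: unpickle => [i|//]; case: asboolP => // Di Ft; exists i.
have mU : measurable (\bigcup_k G k) by exact: bigcup_measurable.
apply/pvm_mass_eq0 => //; apply/eqP; rewrite eq_le measure_ge0 andbT.
apply: le_trans (measure_sigma_subadditive (pvm_mass ipN Epvm x) mG mU _) _.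
  exact: subset_refl.
rewrite eseries0// => k _ _; exact: G0.
Qed.

End pvm_mass.

(** [E U] lies below [E' U] as a projection. Inclusion of kernels is preferred to
    inclusion of ranges because null vectors pass to countable unions. *)
Definition pvm_le (R : realType) (H : completeNormedModType R[i])
    (T : Type) (E E' : set T -> {linear H -> H}) (U : set T) :=
  forall x, E' U x = 0 -> E U x = 0.

Section pvm_le.
Variables (R : realType) (H : completeNormedModType R[i]).
Variables (ip : {dot H for Num.conj}) (ipN : induces_norm ip).
Variables (d : measure_display) (T : measurableType d).

Local Notation "<[ x , y ]>" := (rdot ip x y)
  (at level 0, format "<[ x ,  y ]>").

(** Orthogonal complements reverse the inclusion of kernels, and the kernel of
    [E (~` U)] is the range of [E U]. *)
Lemma pvm_leC (E E' : set T -> {linear H -> H}) U :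
  projection_valued_measure ip E -> projection_valued_measure ip E' ->
  measurable U -> pvm_le E E' U -> pvm_le E' E (~` U).
Proof.
move=> Epvm E'pvm mU EU x Ex.
have mC := measurableC mU.
have vU : E U (E' (~` U) x) = 0.
  by apply: EU; rewrite -(pvmI E'pvm)// setICr (pvm_set0 E'pvm).
apply: (rdot_eq0 ipN); rewrite -(pvm_rdot E'pvm)//.
have xE : E U x = x by apply/(pvm_fixP ipN Epvm).
by rewrite -[X in rdot _ _ X]xE -(pvm_sym Epvm)// vU rdot0l.
Qed.

Variables E E' : set T -> {linear H -> H}.
Hypotheses (Epvm : projection_valued_measure ip E).
Hypotheses (E'pvm : projection_valued_measure ip E').

Lemma pvm_le_bigcup (I : countType) (D : set I) (F : I -> set T) :
  (forall i, D i -> measurable (F i)) ->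
  measurable (\bigcup_(i in D) F i) ->
  (forall i, D i -> pvm_le E E' (F i)) -> pvm_le E E' (\bigcup_(i in D) F i).
Proof.
move=> mF mU FE x x0; apply: (pvm_null_bigcup ipN Epvm) => // i Di.
apply: FE => //; apply: (pvm_null_subset E'pvm (mF _ Di) mU _ x0).
exact: bigcup_sup.
Qed.

(** [E U = E U \o E' U], and [E U] is a contraction. *)
Lemma pvm_le_mass U x : measurable U -> pvm_le E E' U ->
  (pvm_mass ipN Epvm x U <= pvm_mass ipN E'pvm x U)%E.
Proof.
move=> mU EU; have mC := measurableC mU.
have EUx : E U (E' U x) = E U x.
  apply/esym/eqP; rewrite -subr_eq0 -linearB -(pvmC ipN E'pvm)//.
  by apply/eqP/EU; rewrite -(pvmI E'pvm)// setICr (pvm_set0 E'pvm).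
rewrite !pvm_massE// lee_fin (pvm_rdot Epvm)// (pvm_rdot E'pvm)// -EUx.
exact: pvm_contract ipN Epvm _ _ mU.
Qed.

End pvm_le.

(** * Spectral projections of rays for one self-adjoint operator *)

Lemma le0_geometric (R : realType) (a b w C : R) :
  0 <= b -> b < a -> (forall k, a ^+ k * w <= C * b ^+ k) -> w <= 0.
Proof.
move=> b0 ba wab; have a0 : 0 < a by exact: le_lt_trans ba.
have r1 : `|b / a| < 1.
  by rewrite ger0_norm ?ltr_pdivrMr ?mul1r// divr_ge0// ltW.
have cvg0 : (fun k => C * (b / a) ^+ k) @ \oo --> (0 : R).
  by rewrite -[X in _ --> X](mulr0 C); apply: cvgMr; exact: cvg_expr.
rewrite -(cvg_lim _ cvg0)//; apply: limr_ge; first exact: cvgP cvg0.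
by apply: nearW => k; rewrite expr_div_n mulrA ler_pdivlMr ?exprn_gt0// mulrC.
Qed.

Section spectral_measure.
Variables (R : realType) (H : completeNormedModType R[i]).
Variables (ip : {dot H for Num.conj}) (ipN : induces_norm ip).

Local Notation "<[ x , y ]>" := (rdot ip x y)
  (at level 0, format "<[ x ,  y ]>").

(** A symmetric operator that preserves the range of an orthogonal projection
    also preserves its orthogonal complement. *)
Lemma commute_of_invariant (S P : H -> H) :
  (forall x y, <[S x, y]> = <[x, S y]>) ->
  (forall x y, <[P x, y]> = <[x, P y]>) ->
  (forall x, P (S (P x)) = S (P x)) -> forall x, P (S x) = S (P x).
Proof.
move=> Ssym Psym PSP x; rewrite -PSP; apply/eqP; rewrite -subr_eq0; apply/eqP.
apply: (rdot_eq0r ipN) => y.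
by rewrite rdotBl !(Psym _ y) !Ssym Psym PSP subrr.
Qed.

Variables (A : {linear H -> H}) (E : set R -> {linear H -> H}).
Hypotheses (A_sa : self_adjoint ip A) (EA : spectral_measure_of ip A E).

Lemma spectral_pvm : projection_valued_measure ip E.
Proof. by case: EA. Qed.

Local Notation Epvm := spectral_pvm.
Local Notation mass := (pvm_mass ipN Epvm).

Lemma spectral_form x : (<[A x, x]>)%:E = (\int[mass x]_t t%:E)%E.
Proof.
case: (EA) => _ _ [_ /(_ x)[_ ->]]; exact: integral_scalar_measure.
Qed.

(** The scalar measure of a vector in the range of [E B] is carried by [B]. *)
Lemma spectral_form_bound B x (l u : R) : measurable B -> E B x = x ->
  (forall t, B t -> l <= t <= u) ->
  l * <[x, x]> <= <[A x, x]> <= u * <[x, x]>.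
Proof.
move=> mB xB Blu.
have xC : mass x (~` B) = 0%E.
  by apply/pvm_mass_eq0; [exact: measurableC|exact/(pvm_fixP ipN Epvm)].
have AE : (<[A x, x]>)%:E = (\int[mass x]_(t in B) t%:E)%E.
  rewrite spectral_form [RHS]integral_mkcond; apply: ae_eq_integral => //.
  - apply/(measurable_restrictT _ mB); apply/measurable_EFinP.
    exact: measurable_id.
  - exists (~` B); split => //; first exact: measurableC.
    move=> t /= /not_implyP[_]; apply: contra_not => Bt.
    by rewrite patchE mem_set.
have iB : (mass x).-integrable B (EFin \o id).
  apply: measurable_bounded_integrable => //.
  - by rewrite /= pvm_massE// ltry.
  - exists (`|l| + `|u|); split; first exact: num_real.
    move=> c luc t /Blu lut /=; apply: le_trans (ltW luc).
    have := ler_norm u; have := ler_norm (- l); rewrite normrN ler_norml.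
    have := normr_ge0 l; have := normr_ge0 u; lra.
have ic c : (mass x).-integrable B (EFin \o cst c).
  exact: finite_measure_integrable_cst.
have mBE : fine (mass x B) = <[x, x]> by rewrite /= pvm_massE// xB.
rewrite -mBE -!Rintegral_cst//.
have -> : <[A x, x]> = \int[mass x]_(t in B) t by rewrite /Rintegral -AE.
apply/andP; split; apply: le_Rintegral => //; try exact: ic.
- by move=> t /Blu/andP[].
- by move=> t /Blu/andP[].
Qed.

(** The vectors [u + v] and [u - v] have the same scalar measure, since the cross
    terms vanish; hence they give [A] the same form, and the two values differ by
    [4 <[A u, v]>]. *)
Lemma spectral_orthogonal B u v : measurable B -> E B u = u -> E B v = 0 ->
  <[A u, v]> = 0.
Proof.
move=> mB uB vB.
have mass_sum (r : R) C : measurable C -> r ^+ 2 = 1 ->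
    mass (u + r%:C *: v) C = (mass u C + mass v C)%E.
  move=> mC r1; rewrite !pvm_massE// -EFinD; congr EFin.
  have uv : <[E C u, v]> = 0.
    rewrite -uB -(pvmI Epvm)// setIC (pvmI Epvm)// (pvm_sym Epvm)// vB.
    exact: rdot0r.
  rewrite linearD linearZ_LR rdotDl !rdotDr !rdotZl !rdotZr uv.
  rewrite (pvm_sym Epvm v u)// (rdotC ip v (E C u)) uv !mulr0 addr0 add0r mulrA.
  by rewrite -expr2 r1 mul1r.
have eq_form (r : R) : r ^+ 2 = 1 ->
    <[A (u + r%:C *: v), u + r%:C *: v]> = <[A (u + v), u + v]>.
  move=> r1; apply: EFin_inj; rewrite !spectral_form.
  apply: eq_measure_integral => C mC _.
  have {2}-> : v = (1 : R)%:C *: v by rewrite scale1r.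
  by rewrite /= !mass_sum ?expr1n.
have := eq_form (-1); rewrite sqrrN expr1n => /(_ erefl).
rewrite !linearD linearZ_LR !rdotDl !rdotDr !rdotZl !rdotZr.
rewrite (self_adjoint_rdot A_sa v u) (rdotC ip v (A u)); lra.
Qed.

Lemma spectral_commute B x : measurable B -> E B (A x) = A (E B x).
Proof.
move=> mB; apply: (commute_of_invariant (self_adjoint_rdot A_sa)).
  by move=> y z; exact: (pvm_sym Epvm).
move=> y; apply/esym/eqP; rewrite -subr_eq0; apply/eqP/(rdot_eq0 ipN).
set w := _ - _.
have w0 : E B w = 0 by rewrite linearB (pvm_idem Epvm)// subrr.
rewrite {1}/w rdotBl (spectral_orthogonal mB) ?(pvm_idem Epvm)//.
by rewrite (pvm_sym Epvm)// w0 rdot0r subrr.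
Qed.

Lemma measurable_absle (c : R) : measurable [set t : R | `|t| <= c].
Proof.
rewrite (_ : [set t | _] = `[- c, c]%classic)//.
by apply/seteqP; split=> t /=; rewrite in_itv /= ler_norml.
Qed.

Lemma spectral_support : exists2 M : R, 0 <= M &
  forall x c, M <= c -> E [set t | `|t| <= c] x = x.
Proof.
case: (EA) => _ [M EM] _; exists `|M| => // x c Mc.
have mM : measurable [set t : R | M < `|t|].
  rewrite (_ : [set t | _] = ~` [set t : R | `|t| <= M]).
    by apply: measurableC; exact: measurable_absle.
  by apply/seteqP; split=> t /=; rewrite ltNge => /negP.
have mc := measurable_absle c.
apply/(pvm_fixP ipN Epvm _ mc).
apply: (pvm_null_subset Epvm _ mM _ (EM x)); first exact: measurableC.
move=> t /= /negP; rewrite -ltNge; apply: le_lt_trans.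
exact: le_trans (ler_norm M) Mc.
Qed.

Lemma spectral_ray_ge s x : E `]s, +oo[ x = x ->
  s * <[x, x]> <= <[A x, x]>.
Proof.
move=> xs; have [M _ EM] := spectral_support; have mM := measurable_absle M.
have xB : E (`]s, +oo[ `&` [set r : R | `|r| <= M]) x = x.
  by rewrite (pvmI Epvm)// EM.
have /andP[//] : s * <[x, x]> <= <[A x, x]> <= M * <[x, x]>.
apply: spectral_form_bound xB _; first exact: measurableI.
by move=> r [/=]; rewrite in_itv /= andbT ler_norml => /ltW -> /andP[_ ->].
Qed.

Lemma spectral_ray_le t x : E `]t, +oo[ x = 0 -> <[A x, x]> <= t * <[x, x]>.
Proof.
rewrite -[X in E X]setCK => /(pvm_fixP ipN Epvm) xt.
have mC : measurable (~` `]t, +oo[%classic : set R) by exact: measurableC.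
have [M _ EM] := spectral_support; have mM := measurable_absle M.
have xB : E (~` `]t, +oo[ `&` [set r : R | `|r| <= M]) x = x.
  by rewrite (pvmI Epvm)// EM// xt.
have /andP[//] : - M * <[x, x]> <= <[A x, x]> <= t * <[x, x]>.
apply: spectral_form_bound xB _; first exact: measurableI.
move=> r [/=]; rewrite in_itv /= andbT => /negP; rewrite -leNgt ler_norml.
by move=> -> /andP[->].
Qed.

Lemma spectral_ray_null t x : (forall s, t < s -> E `]s, +oo[ x = 0) ->
  E `]t, +oo[ x = 0.
Proof.
move=> x0; rewrite (_ : `]t, +oo[%classic =
  \bigcup_(q in [set q : rat | t < ratr q]) (`]ratr q, +oo[%classic : set R)).
  by apply: (pvm_null_bigcup ipN Epvm) => q //= tq; exact: x0.
apply/seteqP; split=> r /=.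
  rewrite in_itv /= andbT => tr; have [q] := rat_in_itvoo tr.
  by rewrite in_itv /= => /andP[tq qr]; exists q; rewrite //= in_itv /= qr.
by move=> [q /= tq]; rewrite !in_itv /= !andbT; exact: lt_trans.
Qed.

(** For [t < s] let [W = E ]s, oo[ \o S \o E ]-oo, t]], and let [D = A - c] with
    [c] below the spectrum of [A]. Then [W] commutes with [D], which stretches
    the range of [E ]s, oo[] by at least [s - c] and the one of [E ]-oo, t]] by at
    most [t - c]. Iterating, [(s - c)^k |W x|] is at most a constant times
    [(t - c)^k], so that [W = 0]. As [s] decreases to [t] this says that [S]
    preserves the range of [E ]-oo, t]], and symmetry gives the commutation. *)
Lemma commute_spectral_ray (S : {linear H -> H}) t :
  bounded_op S -> self_adjoint ip S -> commuting S A ->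
  forall x, E `]t, +oo[ (S x) = S (E `]t, +oo[ x).
Proof.
move=> S_bounded S_sa SA.
have mray r : measurable (`]r, +oo[%classic : set R) by exact: measurable_itv.
have mQ : measurable (~` (`]t, +oo[%classic : set R)) by exact: measurableC.
have [M M0 EM] := spectral_support.
have [K K0 SK] := bounded_op_rdot ipN S_bounded.
(* Below [- M], so that [A - c] is positive, and below [t], so that [t - c] is
   nonnegative. *)
pose c := - (M + `|t|).
have Mc : M <= M + `|t| by rewrite lerDl.
have ct : c <= t.
  have := ler_norm (- t); rewrite normrN /c; lra.
have mc := measurable_absle (M + `|t|).
pose D : {linear H -> H} := (A \- (c%:C \*: idfun)).
have DE x : D x = A x - c%:C *: x by [].
have Dform x y : <[D x, y]> = <[A x, y]> - c * <[x, y]>.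
  by rewrite DE rdotBl rdotZl.
have Dsym x y : <[D x, y]> = <[x, D y]>.
  by rewrite Dform (self_adjoint_rdot A_sa) DE rdotBr rdotZr.
have D0 x : 0 <= <[D x, x]>.
  rewrite Dform subr_ge0.
  have /andP[//] : c * <[x, x]> <= <[A x, x]> <= - c * <[x, x]>.
  apply: spectral_form_bound mc (EM x _ Mc) _ => r /=.
  by rewrite ler_norml opprK.
have DEc B x : measurable B -> E B (D x) = D (E B x).
  by move=> mB; rewrite !DE linearB linearZ_LR spectral_commute.
have SD x : S (D x) = D (S x).
  by rewrite !DE linearB linearZ_LR SA.
have DQ x : E (~` `]t, +oo[) x = x ->
    <[D x, D x]> <= (t - c) ^+ 2 * <[x, x]>.
  move=> xQ.
  have upper y : E (~` `]t, +oo[) y = y -> <[D y, y]> <= (t - c) * <[y, y]>.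
    move=> yQ; rewrite Dform mulrBl lerD2r; apply: spectral_ray_le.
    by rewrite -[X in E X]setCK; apply/(pvm_fixP ipN Epvm).
  (* Cauchy-Schwarz for the form of [D], applied to [x] and [D x]. *)
  have xD : <[D x, D x]> <= (t - c) * <[D x, x]>.
    have := form_cauchy_schwarz x (D x) Dsym D0.
    have := upper (D x); rewrite DEc// xQ => /(_ erefl).
    have := D0 x; have := rdot_ge0 ipN (D x).
    set a := <[D x, D x]>; set b := <[D x, x]>; set e := <[D (D x), D x]>.
    move=> a0 b0 ea abe.
    have [->|an0] := eqVneq a 0; first by rewrite mulr_ge0 ?subr_ge0.
    have agt0 : 0 < a by rewrite lt_def an0.
    rewrite -(ler_pM2r agt0); have := ler_wpM2l b0 ea; lra.
  have := upper _ xQ; have : 0 <= t - c by rewrite subr_ge0.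
  nra.
have DP s x : t < s -> E `]s, +oo[ x = x ->
    (s - c) ^+ 2 * <[x, x]> <= <[D x, D x]>.
  move=> ts xP.
  have lower : (s - c) * <[x, x]> <= <[D x, x]>.
    by rewrite Dform mulrBl lerD2r; exact: spectral_ray_ge.
  have := cauchy_schwarz ipN (D x) x.
  have := rdot_ge0 ipN x; have := D0 x.
  have sc : 0 < s - c by rewrite subr_gt0 (le_lt_trans ct).
  move: lower; set a := <[x, x]>; set b := <[D x, x]>; set e := <[D x, D x]>.
  move=> ab b0 a0 bea.
  have [->|an0] := eqVneq a 0; first by rewrite mulr0 rdot_ge0.
  have agt0 : 0 < a by rewrite lt_def an0.
  rewrite -(ler_pM2r agt0); apply: le_trans bea.
  rewrite -mulrA -expr2 -exprMn lerXn2r// nnegrE.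
  by rewrite mulr_ge0// ltW.
have W0 s x : t < s -> E `]s, +oo[ (S (E (~` `]t, +oo[) x)) = 0.
  move=> ts.
  pose W y := E `]s, +oo[ (S (E (~` `]t, +oo[) y)).
  have WP y : E `]s, +oo[ (W y) = W y by rewrite /W (pvm_idem Epvm).
  have WD y : W (D y) = D (W y) by rewrite /W DEc// SD DEc.
  have WQ y : W (E (~` `]t, +oo[) y) = W y by rewrite /W (pvm_idem Epvm).
  have Wk k : forall y, ((s - c) ^+ 2) ^+ k * <[W y, W y]> <=
      K * ((t - c) ^+ 2) ^+ k * <[y, y]>.
    elim: k => [|k IHk] y.
      rewrite !expr0 mul1r mulr1.
      apply: le_trans (pvm_contract ipN Epvm _ (mray s)) _.
      apply: le_trans (SK _) _; apply: ler_wpM2l => //.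
      exact: (pvm_contract ipN Epvm _ mQ).
    rewrite (exprSr _ k) -mulrA.
    apply: (@le_trans _ _ (((s - c) ^+ 2) ^+ k * <[D (W y), D (W y)]>)).
      apply: ler_wpM2l; last exact: DP.
      by rewrite !exprn_ge0// subr_ge0 (le_trans ct)// ltW.
    rewrite -WD -WQ DEc//; apply: le_trans (IHk _) _.
    rewrite (exprSr _ k) mulrA -[leRHS]mulrA; apply: ler_wpM2l.
      by rewrite mulr_ge0// exprn_ge0// sqr_ge0.
    apply: le_trans (DQ _ (pvm_idem Epvm _ mQ)) _.
    by apply: ler_wpM2l; [exact: sqr_ge0|exact: (pvm_contract ipN Epvm _ mQ)].
  apply: (rdot_le0 ipN).
  apply: (@le0_geometric _ ((s - c) ^+ 2) ((t - c) ^+ 2) _ (K * <[x, x]>)).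
  - exact: sqr_ge0.
  - by rewrite ltrXn2r// ?nnegrE ?subr_ge0 ?(le_trans ct (ltW ts))// ltrD2r.
  - by move=> k; rewrite mulrAC; exact: Wk.
have WP0 x : E `]t, +oo[ (S (E (~` `]t, +oo[) x)) = 0.
  by apply: spectral_ray_null => s; exact: W0.
have QS x : E (~` `]t, +oo[) (S x) = S (E (~` `]t, +oo[) x).
  apply: (commute_of_invariant (self_adjoint_rdot S_sa)).
    by move=> y z; exact: (pvm_sym Epvm).
  move=> y; apply/(pvm_fixP ipN Epvm _ mQ); rewrite setCK; exact: WP0.
move=> x; have := QS x; rewrite !(pvmC ipN Epvm)// linearB.
by move=> /addrI /oppr_inj.
Qed.

Hypothesis A_le0 : op_le ip A (fun=> 0).

Lemma spectral_ray_nonpos x : E `]0, +oo[ x = 0.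
Proof.
apply: spectral_ray_null => s s0.
have ms : measurable (`]s, +oo[%classic : set R) by exact: measurable_itv.
apply: (rdot_le0 ipN); rewrite -(pmulr_rle0 _ s0).
apply: le_trans (spectral_ray_ge (pvm_idem Epvm _ ms)) _.
by apply: le_trans (op_le_rdot A_le0 _) _; rewrite rdot0l.
Qed.

End spectral_measure.

(** For [x] in the kernel of [E' ]t, oo[] and [s > t], commutation keeps
    [y = E ]s, oo[ x] in that kernel, whence
    [s |y|^2 <= <[A y, y]> <= <[A' y, y]> <= t |y|^2] and [y = 0]. *)
Lemma spectral_ray_pvm_le (R : realType) (H : completeNormedModType R[i])
    (ip : {dot H for Num.conj}) (ipN : induces_norm ip)
    (A A' : {linear H -> H}) (E E' : set R -> {linear H -> H}) (t : R) :
  self_adjoint ip A -> self_adjoint ip A' -> bounded_op A' ->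
  commuting A A' -> op_le ip A A' ->
  spectral_measure_of ip A E -> spectral_measure_of ip A' E' ->
  pvm_le E E' `]t, +oo[%classic.
Proof.
move=> A_sa A'_sa A'_bounded AA' A_le_A' EA EA' x x0.
have Epvm := spectral_pvm EA.
apply: (spectral_ray_null ipN EA) => s ts.
have ms : measurable (`]s, +oo[%classic : set R) by exact: measurable_itv.
set y := E _ x.
have y0 : E' `]t, +oo[%classic y = 0.
  rewrite /y (commute_spectral_ray ipN A'_sa EA').
  - by rewrite x0 linear0.
  - exact: pvm_bounded Epvm _ ms.
  - exact: pvm_sa Epvm _ ms.
  - by move=> z; rewrite (commute_spectral_ray ipN A_sa EA).
have : s * rdot ip y y <= t * rdot ip y y.
  apply: le_trans (spectral_ray_ge ipN EA (pvm_idem Epvm _ ms)) _.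
  apply: le_trans (op_le_rdot A_le_A' _) _.
  exact: (spectral_ray_le ipN EA').
move=> sty; apply: (rdot_le0 ipN); move: sty.
by rewrite -subr_ge0 -mulrBl nmulr_rge0// subr_lt0.
Qed.

(** * Borel sets of R^n and joint spectral measures *)

Section borelRn.
Variables (R : realType) (n : nat).

Definition ray (j : 'I_n) (c : R) : set (borelRn R n) :=
  [set s | c < (s : 'rV[R]_n) 0 j].

Definition nonpos_orthant : set (borelRn R n) :=
  [set s | forall j, (s : 'rV[R]_n) 0 j <= 0].

Definition above (q : 'rV[R]_n) : set (borelRn R n) :=
  [set s | forall j, q 0 j < (s : 'rV[R]_n) 0 j].

Lemma open_measurable_borelRn (U : set 'rV[R]_n) :
  open U -> measurable (U : set (borelRn R n)).
Proof. by move=> oU; apply: sub_sigma_algebra. Qed.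

Lemma open_ray j c : open (ray j c : set 'rV[R]_n).
Proof.
apply: (@open_comp _ _ (fun s : 'rV[R]_n => s 0 j) [set t | c < t]).
  by move=> s _; exact: coord_continuous.
exact: open_gt.
Qed.

Lemma measurable_ray j c : measurable (ray j c).
Proof. by apply: open_measurable_borelRn; exact: open_ray. Qed.

Lemma setC_above q : ~` above q = \bigcup_(j in setT) ~` ray j (q 0 j).
Proof.
apply/seteqP; split=> s /= => [/existsNP[j qj]|[j _ qj]]; first by exists j.
by apply/existsNP; exists j.
Qed.

Lemma open_above q : open (above q : set 'rV[R]_n).
Proof.
rewrite openE => s sq.
exists (fun _ j => [set t : R | t \in `]q 0 j, +oo[]).
  by move=> i j; rewrite ord1; apply: near_in_itvoy; rewrite in_itv /= andbT.
by move=> t /= tq j; have := tq 0 j; rewrite in_itv /= andbT.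
Qed.

Lemma measurable_above q : measurable (above q).
Proof. by apply: open_measurable_borelRn; exact: open_above. Qed.

Lemma setC_nonpos_orthant :
  ~` nonpos_orthant = \bigcup_(j in setT) ray j 0.
Proof.
apply/seteqP; split=> s /= => [/existsNP[j /negP]|[j _ /=]].
  by rewrite -ltNge => sj; exists j.
by rewrite /ray /= ltNge => /negP sj /(_ j).
Qed.

Lemma measurable_nonpos_orthant : measurable nonpos_orthant.
Proof.
rewrite -[nonpos_orthant]setCK setC_nonpos_orthant; apply: measurableC.
by apply: fin_bigcup_measurable => // j _; exact: measurable_ray.
Qed.

Lemma nbhs_rat_above (s : 'rV[R]_n) (V : set 'rV[R]_n) : nbhs s V ->
  exists q : 'rV[rat]_n,
    V (map_mx ratr q) /\ forall j, ratr (q 0 j) < s 0 j.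
Proof.
move=> /nbhs_ballP[e /= e0 sV].
have near_j j : exists r : rat, s 0 j - e < ratr r < s 0 j.
  have [r] : exists r : rat, ratr r \in `]s 0 j - e, s 0 j[.
    by apply: rat_in_itvoo; rewrite gtrBl.
  by rewrite in_itv /=; exists r.
have [q qP] := choice near_j.
exists (\row_j q j); split; last by move=> j; rewrite mxE; case/andP: (qP j).
apply: sV; split=> // i j; rewrite ord1 !mxE /ball /=.
by case/andP: (qP j) => lo hi; rewrite gtr0_norm ?subr_gt0// ltrBlDr -ltrBlDl.
Qed.

Definition rat_box (ab : 'rV[rat]_n * 'rV[rat]_n) : set 'rV[R]_n :=
  [set s | forall j, ratr (ab.1 0 j) < s 0 j < ratr (ab.2 0 j)].

Lemma open_rat_box ab : open (rat_box ab).
Proof.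
rewrite openE => s sab.
exists (fun _ j => [set t : R | t \in `]ratr (ab.1 0 j), ratr (ab.2 0 j)[]).
  move=> i j; rewrite ord1; apply: near_in_itvoo; rewrite in_itv /=.
  exact: sab.
by move=> t /= tab j; have := tab 0 j; rewrite in_itv.
Qed.

Lemma nbhs_rat_box (s : 'rV[R]_n) (V : set 'rV[R]_n) : nbhs s V ->
  exists2 ab, rat_box ab s & rat_box ab `<=` V.
Proof.
move=> /nbhs_ballP[e /= e0 sV].
have near_j j : exists r : rat * rat,
    s 0 j - e < ratr r.1 < s 0 j /\ s 0 j < ratr r.2 < s 0 j + e.
  have [r] : exists r : rat, ratr r \in `]s 0 j - e, s 0 j[.
    by apply: rat_in_itvoo; rewrite gtrBl.
  have [r'] : exists r : rat, ratr r \in `]s 0 j, s 0 j + e[.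
    by apply: rat_in_itvoo; rewrite ltrDl.
  by rewrite !in_itv /=; exists (r, r').
have [q qP] := choice near_j.
exists (\row_j (q j).1, \row_j (q j).2) => [j|t tq].
  by rewrite !mxE; have [/andP[_ ->] /andP[->]] := qP j.
apply: sV; split=> // i j; rewrite ord1 /ball /= ltr_distlC.
have [/andP[lo _] /andP[_ hi]] := qP j.
have := tq j; rewrite !mxE /= => /andP[/(lt_trans lo) -> /lt_trans]; exact.
Qed.

End borelRn.

Section joint_spectral_measure.
Variables (R : realType) (n : nat) (H : completeNormedModType R[i]).
Variables (ip : {dot H for Num.conj}) (ipN : induces_norm ip).

Lemma big_comp_only (T : Type) (F : 'I_n -> T -> T) j x :
  (forall k, k != j -> F k =1 id) ->
  (\big[(fun S U : T -> T => S \o U)/idfun]_(k < n) F k) x = F j x.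
Proof.
move=> Fid; suff compE r : uniq r ->
    (\big[(fun S U : T -> T => S \o U)/idfun]_(k <- r) F k) x =
    if j \in r then F j x else x.
  by rewrite compE ?index_enum_uniq// mem_index_enum.
elim: r => [|k r IHr] /=; first by rewrite big_nil.
move=> /andP[kr /IHr]; rewrite big_cons inE /= => ->.
have [->|jk] := eqVneq j k; first by rewrite (negbTE kr).
by rewrite Fid// eq_sym.
Qed.

(** A ray is a product set whose other factors are the whole line, on which the
    [E_k] are the identity. *)
Lemma joint_ray (A : 'I_n -> {linear H -> H}) E :
  joint_spectral_measure ip A E ->
  exists Ej : 'I_n -> set R -> {linear H -> H},
    (forall j, spectral_measure_of ip (A j) (Ej j)) /\
    forall j c x, E (ray j c) x = Ej j `]c, +oo[%classic x.
Proof.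
move=> [Ej [EjA _ Eprod]]; exists Ej; split=> // j c x.
pose B k : set R := if k == j then `]c, +oo[%classic else setT.
have mB k : measurable (B k).
  by rewrite /B; case: ifP => // _; exact: measurable_itv.
have -> : ray j c = [set s | forall k, B k ((s : 'rV[R]_n) 0 k)].
  apply/seteqP; split=> s /=.
    by move=> cs k; rewrite /B; case: eqVneq => //= ->; rewrite in_itv /= andbT.
  by move=> /(_ j); rewrite /B eqxx /= in_itv /= andbT.
rewrite Eprod// (big_comp_only (j := j)) /B ?eqxx// => k /negbTE -> y.
by have [[_ _ -> _ _]] := EjA k.
Qed.

End joint_spectral_measure.

Section pvm_Rn.
Variables (R : realType) (n : nat) (H : completeNormedModType R[i]).
Variables (ip : {dot H for Num.conj}) (ipN : induces_norm ip).
Variable E : set (borelRn R n) -> {linear H -> H}.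
Hypothesis Epvm : projection_valued_measure ip E.

Lemma open_pvm_supportC : open (~` pvm_support E : set 'rV[R]_n).
Proof.
rewrite openE => s /= /existsNP[U /not_implyP[oU /not_implyP[Us EU]]].
have : nbhs s U by exact: open_nbhs_nbhs.
apply: filterS => t Ut /(_ U oU Ut) //.
Qed.

Lemma measurable_pvm_support : measurable (pvm_support E).
Proof.
rewrite -[pvm_support E]setCK; apply: measurableC.
by apply: open_measurable_borelRn; exact: open_pvm_supportC.
Qed.

(** The complement of the support is covered by the rational boxes on which [E]
    vanishes, and there are countably many of them. *)
Lemma pvm_support_full x : E (pvm_support E) x = x.
Proof.
apply/(pvm_fixP ipN Epvm _ measurable_pvm_support).
pose D := [set ab | forall y, E (@rat_box R n ab) y = 0].
have mbox ab : measurable (@rat_box R n ab : set (borelRn R n)).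
  by apply: open_measurable_borelRn; exact: open_rat_box.
apply: (@pvm_null_subset _ _ _ _ _ _ Epvm _
  (\bigcup_(ab in D) @rat_box R n ab)).
- by apply: measurableC; exact: measurable_pvm_support.
- apply: open_measurable_borelRn; apply: bigcup_open => ab _.
  exact: open_rat_box.
- move=> s /= /existsNP[U /not_implyP[oU /not_implyP[Us EU]]].
  have [ab sab abU] := nbhs_rat_box (open_nbhs_nbhs (conj oU Us)).
  exists ab => // y; apply: (pvm_null_subset Epvm (mbox _) _ abU).
    exact: open_measurable_borelRn.
  by apply: contrapT => /eqP Uy; apply: EU; exists y.
- by apply: (pvm_null_bigcup ipN Epvm) => ab Dab; [exact: mbox|exact: Dab].
Qed.

Lemma nonpos_orthant_full (A : 'I_n -> {linear H -> H}) x :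
  (forall j, op_le ip (A j) (fun=> 0)) ->
  joint_spectral_measure ip A E ->
  E (nonpos_orthant (n:=n)) x = x.
Proof.
move=> A_le0 /joint_ray[Ej [EjA Eray]].
apply/(pvm_fixP ipN Epvm); first exact: measurable_nonpos_orthant.
rewrite setC_nonpos_orthant.
apply: (pvm_null_bigcup ipN Epvm) => j _; first exact: measurable_ray.
by rewrite Eray (spectral_ray_nonpos ipN (EjA j)).
Qed.

End pvm_Rn.

(** * Monotonicity of functions of class R^- *)

Section class_Rminus_monotone.
Variables (R : realType) (n : nat) (psi : 'rV[R]_n -> R).
Hypothesis psiR : class_Rminus psi.

Local Notation N := (@nonpos_orthant R n).

Lemma class_Rminus_continuous : {within N, continuous psi}.
Proof. by case: psiR. Qed.

Lemma class_Rminus_near (s : 'rV[R]_n) (V : set R) : N s -> nbhs (psi s) V ->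
  nbhs s [set t : 'rV[R]_n | N t -> V (psi t)].
Proof.
move=> sN; have /subspace_continuousP/(_ s sN) := class_Rminus_continuous.
by move=> /[apply].
Qed.

Let kernel (s xi : 'rV[R]_n) : R := (\prod_(j < n) (xi 0 j - s 0 j))^-1.

Let O : set (borelRn R n) := [set xi | forall j, 0 <= (xi : 'rV[R]_n) 0 j].

Let measurable_O : measurable O.
Proof.
have -> : O = \bigcap_(j in [set: 'I_n]) ~` [set xi : 'rV[R]_n | xi 0 j < 0].
  apply/seteqP; split=> xi /= xi0 j.
    by move=> _; apply/negP; rewrite -leNgt.
  by have /negP := xi0 j I; rewrite -leNgt.
apply: fin_bigcap_measurable => // j _; apply: measurableC.
apply: open_measurable_borelRn.
apply: (@open_comp _ _ (fun s : 'rV[R]_n => s 0 j) [set t | t < 0]).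
  by move=> s _; exact: coord_continuous.
exact: open_lt.
Qed.

(** At a real point the complex kernel takes real values, and the formula becomes
    an identity between real numbers. *)
Let class_Rminus_real (l g : R) (Psi : 'rV[R[i]]_n -> R[i])
    (tau : {measure set (borelRn R n) -> \bar R}) (s : 'rV[R]_n) :
  let z := - map_mx (fun r : R => r%:C) s in
  let kernelC (xi : borelRn R n) :=
    (\prod_(j < n) (((xi : 'rV[R]_n) 0 j)%:C + z 0 j))^-1 in
  Psi (- z) = (psi s)%:C ->
  complex_integrable tau O kernelC ->
  (l%:C - Psi (- z))^-1 = g%:C + complex_integral tau O kernelC ->
  tau.-integrable O (EFin \o kernel s) /\
  (l - psi s)^-1 = g + \int[tau]_(xi in O) kernel s xi.
Proof.
move=> z kernelC ->.
have Re_kernelC : (fun xi => complex.Re (kernelC xi)) = kernel s.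
  apply/funext => xi; rewrite /kernelC /kernel.
  have -> : \prod_(j < n) (((xi : 'rV[R]_n) 0 j)%:C + z 0 j) =
      (\prod_(j < n) ((xi : 'rV[R]_n) 0 j - s 0 j))%:C.
    by rewrite rmorph_prod; apply: eq_bigr => j _; rewrite !mxE rmorphB.
  by rewrite -fmorphV.
rewrite /complex_integrable Re_kernelC => -[ik _].
rewrite -rmorphB -fmorphV /complex_integral Re_kernelC.
by case=> ->.
Qed.

Lemma class_Rminus_le_interior (s t : 'rV[R]_n) :
  (forall j, s 0 j <= t 0 j) -> (forall j, t 0 j < 0) -> psi s <= psi t.
Proof.
case: psiR => _ psi_le0 [Psi [[_ PsiE] [lambda [gamma [tau [l0 g0 rep]]]]]].
move=> st t0; have s0 j : s 0 j < 0 by exact: le_lt_trans (t0 j).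
have repr (u : 'rV[R]_n) : (forall j, u 0 j < 0) ->
    tau.-integrable O (EFin \o kernel u) /\
    (lambda - psi u)^-1 = gamma + \int[tau]_(xi in O) kernel u xi.
  move=> u0.
  have [|_ iu uE] := rep (- map_mx (fun r : R => r%:C) u).
    by move=> j; rewrite !mxE /= oppr_gt0.
  by apply: class_Rminus_real iu uE; rewrite opprK PsiE.
have [is_ sE] := repr s s0; have [it tE] := repr t t0.
have lpos (u : 'rV[R]_n) : (forall j, u 0 j < 0) -> 0 < lambda - psi u.
  move=> u0; rewrite subr_gt0; apply: le_lt_trans l0.
  by apply: psi_le0 => j; exact: ltW.
rewrite -(lerD2l (- lambda)) -lerN2 !opprD !opprK -lef_pV2 ?posrE ?lpos//.
rewrite sE tE lerD2l; apply: le_Rintegral => // xi xi0.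
have xipos u j : u < 0 -> 0 < (xi : 'rV[R]_n) 0 j - u.
  by move=> u0; rewrite subr_gt0; exact: lt_le_trans (xi0 j).
rewrite /kernel lef_pV2 ?posrE ?prodr_gt0// => [|j _|j _]; last 2 first.
- exact: xipos.
- exact: xipos.
by apply: ler_prod => j _; rewrite lerD2l lerN2 st andbT ltW// xipos.
Qed.

Lemma nbhs_shift (s : 'rV[R]_n) (V : set 'rV[R]_n) : nbhs s V ->
  exists2 e : R, 0 < e & forall d, 0 < d < e -> V (s - const_mx d).
Proof.
move=> /nbhs_ballP[e /= e0 sV]; exists e => // d /andP[d0 de].
apply: sV; split=> // i j; rewrite !mxE /ball /= opprB addrC subrK.
by rewrite gtr0_norm.
Qed.

(** If [psi t < c < psi s], continuity keeps these strict inequalities after both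
    points are moved inside the orthant by the same small vector, which
    contradicts the monotonicity there. *)
Lemma class_Rminus_le (s t : 'rV[R]_n) :
  (forall j, s 0 j <= t 0 j) -> N t -> psi s <= psi t.
Proof.
move=> st tN; have sN : N s by move=> j; exact: le_trans (tN j).
rewrite leNgt; apply/negP => /midf_lt[]; set c := _ / _ => tc cs.
have [e1 e10 e1P] := nbhs_shift (class_Rminus_near sN (lt_nbhsr cs)).
have [e2 e20 e2P] := nbhs_shift (class_Rminus_near tN (lt_nbhsl tc)).
pose d := Num.min e1 e2 / 2.
have m0 : 0 < Num.min e1 e2 by rewrite lt_min e10.
have d0 : 0 < d by rewrite divr_gt0.
have dm : d < Num.min e1 e2 by rewrite ltr_pdivrMr// ltr_pMr// ltr1n.
have /andP[de1 de2] : (d < e1) && (d < e2) by rewrite -lt_min.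
have shift_lt0 (u : 'rV[R]_n) j : N u -> (u - const_mx d) 0 j < 0.
  by move=> uN; rewrite !mxE subr_lt0; exact: le_lt_trans d0.
have : psi (s - const_mx d) <= psi (t - const_mx d).
  apply: class_Rminus_le_interior => j; last exact: shift_lt0.
  by rewrite !mxE lerD2r.
apply/negP; rewrite -ltNge; apply: (@lt_trans _ _ c).
- by apply: e2P; [rewrite d0|move=> j; exact/ltW/shift_lt0].
- by apply: e1P; [rewrite d0|move=> j; exact/ltW/shift_lt0].
Qed.

End class_Rminus_monotone.

(** * Order of the joint spectral projections of level sets *)

Section joint_le.
Variables (R : realType) (n : nat) (H : completeNormedModType R[i]).
Variables (ip : {dot H for Num.conj}) (ipN : induces_norm ip).
Variables A A' : 'I_n -> {linear H -> H}.
Hypotheses (A'_bounded : forall j, bounded_op (A' j)).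
Hypotheses (A_sa : forall j, self_adjoint ip (A j)).
Hypotheses (A'_sa : forall j, self_adjoint ip (A' j)).
Hypotheses (A_le0 : forall j, op_le ip (A j) (fun=> 0)).
Hypotheses (A'_le0 : forall j, op_le ip (A' j) (fun=> 0)).
Hypotheses (AA' : forall j, commuting (A j) (A' j)).
Hypotheses (A_le_A' : forall j, op_le ip (A j) (A' j)).
Variables E E' : set (borelRn R n) -> {linear H -> H}.
Hypotheses (EA : joint_spectral_measure ip A E).
Hypotheses (EA' : joint_spectral_measure ip A' E').

Let Epvm : projection_valued_measure ip E.
Proof. by case: EA => ? []. Qed.

Let E'pvm : projection_valued_measure ip E'.
Proof. by case: EA' => ? []. Qed.

Lemma ray_pvm_le j c : pvm_le E E' (ray j c).
Proof.
have [Ej [EjA rayE]] := joint_ray EA.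
have [Ej' [EjA' rayE']] := joint_ray EA'.
move=> x; rewrite rayE rayE'.
by apply: (spectral_ray_pvm_le ipN _ _ _ _ _ (EjA j) (EjA' j)).
Qed.

Lemma above_pvm_le q : pvm_le E E' (above q).
Proof.
have mC : measurable (~` above q).
  by apply: measurableC; exact: measurable_above.
rewrite -[above q]setCK; apply: (pvm_leC ipN E'pvm Epvm mC).
rewrite setC_above in mC *; apply: (pvm_le_bigcup ipN E'pvm Epvm) => // j _.
  by apply: measurableC; exact: measurable_ray.
by apply: (pvm_leC ipN Epvm E'pvm); [exact: measurable_ray|exact: ray_pvm_le].
Qed.

Variable psi : 'rV[R]_n -> R.
Hypothesis psiR : class_Rminus psi.

Local Notation N := (@nonpos_orthant R n).

Definition superlevel c : set (borelRn R n) := N `&` [set s | c < psi s].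

Definition superlevel_cover c : set (borelRn R n) :=
  \bigcup_(q in [set q : 'rV[rat]_n | superlevel c (map_mx ratr q)])
    above (map_mx ratr q).

(** By continuity a point of the superlevel set dominates strictly some rational
    point of it, and by monotonicity every point above the latter belongs to
    it. *)
Lemma superlevelE c : superlevel c = N `&` superlevel_cover c.
Proof.
apply/seteqP; split=> s [sN] /=.
  move=> cs; split=> //.
  have [q [qU qs]] := nbhs_rat_above (class_Rminus_near psiR sN (lt_nbhsr cs)).
  have qN : N (map_mx ratr q).
    by move=> j; rewrite mxE; exact: le_trans (ltW (qs j)) (sN j).
  exists q => /=; first by split => //; exact: qU.
  by move=> j; rewrite mxE.
move=> [q [qN cq] qs]; split => //=.
by apply: lt_le_trans cq _; apply: (class_Rminus_le psiR) => // j; exact: ltW.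
Qed.

Lemma measurable_superlevel_cover c : measurable (superlevel_cover c).
Proof.
apply: open_measurable_borelRn; apply: bigcup_open => q _; exact: open_above.
Qed.

Lemma measurable_superlevel c : measurable (superlevel c).
Proof.
rewrite superlevelE; apply: measurableI; first exact: measurable_nonpos_orthant.
exact: measurable_superlevel_cover.
Qed.

Lemma superlevel_pvm_le c : pvm_le E E' (superlevel c).
Proof.
move=> x x0.
have mN := @measurable_nonpos_orthant R n.
apply: (pvm_null_subset Epvm (measurable_superlevel c)
  (measurable_superlevel_cover c)).
  by rewrite superlevelE; exact: subIsetr.
apply: (pvm_null_bigcup ipN Epvm) => q [_ /= cq]; first exact: measurable_above.
apply: above_pvm_le; rewrite -(nonpos_orthant_full ipN E'pvm x A'_le0 EA').
have mq := measurable_above (map_mx ratr q : 'rV[R]_n).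
rewrite -(pvmI E'pvm)//.
apply: (pvm_null_subset E'pvm _ (measurable_superlevel c) _ x0).
  exact: measurableI.
move=> s [qs sN]; split=> //=.
by apply: lt_le_trans cq _; apply: (class_Rminus_le psiR) => // j; exact: ltW.
Qed.

Lemma measurable_class_Rminus : measurable_fun N (psi : borelRn R n -> R).
Proof.
move=> mN; apply: (measurability _ (RGenOInfty.measurableE R)) => //.
move=> _ [_ [c ->] <-]; rewrite (_ : _ `&` _ = superlevel c).
  exact: measurable_superlevel.
by apply/seteqP; split=> s [sN] /=; rewrite in_itv /= andbT.
Qed.

(** Inside the orthant [{psi < c}] is the union over rational [q < c] of the
    complements of the superlevel sets [{psi > q}], where the order of the
    projections is reversed. *)
Lemma sublevel_pvm_le c : pvm_le E' E (N `&` [set s | psi s < c]).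
Proof.
move=> x x0.
have mN := @measurable_nonpos_orthant R n.
have mS : measurable (N `&` [set s | psi s < c]).
  rewrite (_ : _ `&` _ = N `&` psi @^-1` `]-oo, c[).
    exact: measurable_class_Rminus.
  by apply/seteqP; split=> s [sN] /=; rewrite in_itv.
have mC q : measurable (~` superlevel q).
  by apply: measurableC; exact: measurable_superlevel.
have -> : N `&` [set s | psi s < c] =
    \bigcup_(q in [set q : rat | ratr q < c]) (~` superlevel (ratr q) `&` N).
  apply/seteqP; split=> s /=.
    move=> [sN /= sc]; have [q] := rat_in_itvoo sc.
    rewrite in_itv /= => /andP[sq qc]; exists q => //; split=> //.
    by case=> _ /=; rewrite ltNge (ltW sq).
  move=> [q /= qc [sq sN]]; split=> //=; apply: le_lt_trans qc.
  by rewrite leNgt; apply/negP => qs; apply: sq.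
apply: (pvm_null_bigcup ipN E'pvm) => q /= qc; first exact: measurableI.
rewrite setIC (pvmI E'pvm)//.
suff -> : E' (~` superlevel (ratr q)) x = 0 by rewrite linear0.
apply: (pvm_leC ipN Epvm E'pvm).
- exact: measurable_superlevel.
- exact: superlevel_pvm_le.
rewrite -(nonpos_orthant_full ipN Epvm x A_le0 EA) -(pvmI Epvm)//.
apply: (pvm_null_subset Epvm _ mS _ x0); first exact: measurableI.
move=> s [sq sN]; split=> //=; apply: le_lt_trans qc.
by rewrite leNgt; apply/negP => qs; apply: sq.
Qed.

End joint_le.

(** * Integration over level sets *)

(** Layer cake formula: the integral of [f] is the integral over [r >= 0] of the
    mass of [{f > r}]. *)
Lemma le_integral_of_ccdf (R : realType) d (T : measurableType d)
    (P P' : probability T R) (f : {mfun T >-> R}) :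
  (forall t, 0 <= f t) ->
  (forall r : R, 0 <= r ->
    (P' [set t | (r < f t)%R] <= P [set t | (r < f t)%R])%E) ->
  (\int[P']_t (f t)%:E <= \int[P]_t (f t)%:E)%E.
Proof.
move=> f0 PP'.
have layer (Q : probability T R) :
    (\int[Q]_t (f t)%:E =
     \int[lebesgue_measure]_(r in `[0%R, +oo[) ccdf (P:=Q) f r)%E.
  by rewrite -ge0_expectation_ccdf// expectation_def.
rewrite !layer; apply: ge0_le_integral => //.
- by apply: measurable_funS (ccdf_measurable (P:=P') f).
- by apply: measurable_funS (ccdf_measurable (P:=P) f).
- move=> r /=; rewrite in_itv /= andbT => r0.
  have := PP' r r0; rewrite /ccdf /distribution /pushforward /=.
  rewrite (_ : f @^-1` `]r, +oo[ = [set t | r < f t])//.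
  by apply/seteqP; split=> t /=; rewrite in_itv /= andbT.
Qed.

(** * Forms of the functional calculus *)

Section functional_calculus_le.
Variables (R : realType) (n : nat) (psi : 'rV[R]_n -> R).
Hypothesis psiR : class_Rminus psi.
Local Notation N := (@nonpos_orthant R n).

Lemma class_Rminus_nonpos s : N s -> psi s <= 0.
Proof. by case: psiR => _ + _; exact. Qed.

(** [- psi] made measurable and nonnegative on the whole space: outside of the
    orthant [psi] is arbitrary. *)
Definition clipped : borelRn R n -> R := (fun s => - psi s) \_ N.

Lemma clipped_ge0 s : 0 <= clipped s.
Proof.
rewrite /clipped patchE; case: ifPn => // /set_mem sN.
by rewrite oppr_ge0 class_Rminus_nonpos.
Qed.

Lemma measurable_clipped : measurable_fun setT clipped.
Proof.
apply/(measurable_restrictT _ (@measurable_nonpos_orthant R n)).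
by apply: measurable_funN; exact: (measurable_class_Rminus psiR).
Qed.

HB.instance Definition _ :=
  isMeasurableFun.Build _ _ _ _ clipped measurable_clipped.

Lemma clipped_gt r : 0 <= r ->
  [set s | r < clipped s] = N `&` [set s | psi s < - r].
Proof.
move=> r0; apply/seteqP; split=> s /=; rewrite /clipped patchE.
  by case: ifPn => [/set_mem sN|_]; [rewrite ltrNr|rewrite ltNge r0].
by move=> [sN /= sr]; rewrite mem_set// ltrNr.
Qed.

Lemma measurable_clipped_gt r : measurable [set s | r < clipped s].
Proof.
rewrite (_ : [set s | _] = setT `&` clipped @^-1` `]r, +oo[).
  exact: measurable_clipped.
by rewrite setTI; apply/seteqP; split=> s /=; rewrite in_itv /= andbT.
Qed.

Variables (H : completeNormedModType R[i]).
Variables (ip : {dot H for Num.conj}) (ipN : induces_norm ip).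

Lemma functional_calculus_form (A : 'I_n -> {linear H -> H}) E
    (Epvm : projection_valued_measure ip E) (S : H -> H) x :
  (forall j, op_le ip (A j) (fun=> 0)) ->
  joint_spectral_measure ip A E ->
  is_spectral_integral ip E (pvm_support E) psi S ->
  (rdot ip (S x) x)%:E = (- \int[pvm_mass ipN Epvm x]_s (clipped s)%:E)%E.
Proof.
move=> A_le0 EA [_ /(_ x)[_ ->]].
have mS := measurable_pvm_support E.
rewrite (integral_scalar_measure ipN Epvm).
have suppN : pvm_support E `<=` N.
  move=> s sE; apply: contrapT; rewrite -[~ N s]/((~` N) s) setC_nonpos_orthant.
  move=> [j _ sj]; have [y /eqP[]] := sE _ (@open_ray R n j 0) sj.
  have mN := @measurable_nonpos_orthant R n.
  apply: (pvm_null_subset Epvm (measurable_ray j 0) (measurableC mN)).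
    by rewrite setC_nonpos_orthant => t tj; exists j.
  apply/(pvm_fixP ipN Epvm _ mN).
  exact: (nonpos_orthant_full ipN Epvm y A_le0 EA).
have null : pvm_mass ipN Epvm x (~` pvm_support E) = 0%E.
  apply/pvm_mass_eq0; first exact: measurableC.
  by apply/(pvm_fixP ipN Epvm _ mS); exact: pvm_support_full.
rewrite (@ge0_negligible_integral _ _ _ (pvm_mass ipN Epvm x) setT
  (~` pvm_support E))//.
- rewrite setTD setCK -integral_ge0N => [|s _]; last first.
    by rewrite lee_fin clipped_ge0.
  apply: eq_integral => s /set_mem sE; rewrite -EFinN; congr EFin.
  by rewrite /clipped patchE mem_set ?opprK//; exact: suppN.
- exact: measurableC.
- by apply/measurable_EFinP; exact: measurable_clipped.
- by move=> s _; rewrite lee_fin clipped_ge0.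
Qed.

End functional_calculus_le.

Theorem theorem1 (R : realType) (n : nat) (n_ge1 : (1 <= n)%N)
  (psi : 'rV[R]_n -> R) (psiR : class_Rminus psi)
  (H : completeNormedModType R[i]) (ip : {dot H for Num.conj})
  (ipN : induces_norm ip)
  (A A' : 'I_n -> {linear H -> H})
  (A_bounded : forall j, bounded_op (A j))
  (A'_bounded : forall j, bounded_op (A' j))
  (A_sa : forall j, self_adjoint ip (A j))
  (A'_sa : forall j, self_adjoint ip (A' j))
  (A_le0 : forall j, op_le ip (A j) (fun=> 0))
  (A'_le0 : forall j, op_le ip (A' j) (fun=> 0))
  (AA : forall j k, commuting (A j) (A k))
  (A'A' : forall j k, commuting (A' j) (A' k))
  (AA' : forall j k, commuting (A j) (A' k))
  (A_le_A' : forall j, op_le ip (A j) (A' j))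
  (psiA psiA' : {linear H -> H})
  (psiAE : is_functional_calculus ip A psi psiA)
  (psiA'E : is_functional_calculus ip A' psi psiA') :
  op_le ip psiA psiA'.
Proof.
have [E [EA ES]] := psiAE; have [E' [EA' ES']] := psiA'E.
have Epvm : projection_valued_measure ip E by case: EA => ? [].
have E'pvm : projection_valued_measure ip E' by case: EA' => ? [].
(* A unit vector makes the scalar measures probabilities. *)
have unit_le x : rdot ip x x = 1 -> rdot ip (psiA x) x <= rdot ip (psiA' x) x.
  move=> x1; rewrite -lee_fin.
  rewrite (functional_calculus_form psiR ipN Epvm _ A_le0 EA ES).
  rewrite (functional_calculus_form psiR ipN E'pvm _ A'_le0 EA' ES') leeN2.
  have mass1 F (Fpvm : projection_valued_measure ip F) :
      pvm_mass ipN Fpvm x setT = 1%E by rewrite pvm_mass_setT x1.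
  pose P : probability _ R := HB.pack (pvm_mass ipN Epvm x)
    (Measure_isProbability.Build _ _ _ (pvm_mass ipN Epvm x)
      (mass1 _ _ _ Epvm)).
  pose P' : probability _ R := HB.pack (pvm_mass ipN E'pvm x)
    (Measure_isProbability.Build _ _ _ (pvm_mass ipN E'pvm x)
      (mass1 _ _ _ E'pvm)).
  apply: (@le_integral_of_ccdf _ _ _ P P' (clipped psi)) => [s|r r0].
    exact: clipped_ge0.
  rewrite clipped_gt//=; apply: (pvm_le_mass ipN E'pvm Epvm).
    by rewrite -clipped_gt//; exact: measurable_clipped_gt.
  exact: (sublevel_pvm_le ipN A'_bounded A_sa A'_sa A_le0 A'_le0 _ A_le_A'
    EA EA').
have form_le x : rdot ip (psiA x) x <= rdot ip (psiA' x) x.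
  have [->|xn0] := eqVneq x 0; first by rewrite !rdot0r.
  have x0 : 0 < rdot ip x x.
    rewrite lt_def rdot_ge0// andbT; apply: contra_neq xn0; exact: rdot_eq0.
  pose r := (Num.sqrt (rdot ip x x))^-1.
  have r0 : 0 < r by rewrite invr_gt0 sqrtr_gt0.
  have r2 : r * r * rdot ip x x = 1.
    rewrite -[X in _ * X](sqr_sqrtr (ltW x0)) -expr2 -exprMn.
    by rewrite mulVf ?expr1n// gt_eqF ?sqrtr_gt0.
  have := unit_le (r%:C *: x); rewrite !linearZ_LR !rdotZl !rdotZr !mulrA.
  by move=> /(_ r2); rewrite ler_pM2l// mulr_gt0.
move=> x; rewrite lecE; apply/andP; split; last first.
  by rewrite -/(rdot ip _ _) rdotBl subr_ge0.
have [_ /(_ x)[im _]] := ES; have [_ /(_ x)[im' _]] := ES'.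
by rewrite linearBl raddfB /= im im' subrr.
Qed.
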